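(* Let $a_n$ be the number of pop-stacked permutations of $[n]=\{1,\dots,n\}$ and let $F(x)=\sum_{n\ge 0}a_nx^n\in\mathbb{Q}[[x]]$. If $m\ge 1$ and $p_0(x),\dots,p_m(x)\in\mathbb{Q}[x]$ with $p_m\ne 0$ satisfy \[ p_m(x)F(x)^m+\cdots+p_1(x)F(x)+p_0(x)=0, \] and $d=\max(\deg p_0,\dots,\deg p_m)$, then $(m+1)(d+1)>1000$.
   Context: For a permutation $\pi=a_1a_2\cdots a_n$ of $[n]$, a descending run of $\pi$ is a maximal sequence of consecutive letters $a_i>a_{i+1}>\cdots>a_{i+j}$. Factor $\pi$ into its descending runs, $\pi=D_1D_2\cdots D_r$; the pop-stack operator $P$ reverses each run, i.e. $P(\pi)$ is the concatenation of the reversals of $D_1,D_2,\dots,D_r$ in this order. A permutation $\sigma$ of $[n]$ is pop-stacked if $\sigma=P(\pi)$ for some permutation $\pi$ of $[n]$. The empty permutation is counted as pop-stacked, so $a_0=1$. *)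

(* Defs.v *)
From mathcomp Require Import all_boot all_order all_fingroup all_algebra.
Set Implicit Arguments.
Unset Strict Implicit.
Unset Printing Implicit Defensive.
Import GRing.Theory.
Local Open Scope ring_scope.

(* Permutations of [n] are elements of 'S_n (bijections of {0, ..., n-1});
   [one_line s] is the word a_1 a_2 ... a_n on the letters 1, ..., n. *)
Definition one_line (n : nat) (s : 'S_n) : seq nat :=
  [seq (s i).+1 | i <- enum 'I_n].

(* The factorization w = D_1 D_2 ... D_r into maximal descending runs, see
   [desc_runsP] below. *)
Fixpoint desc_runs (w : seq nat) : seq (seq nat) :=
  if w is a :: w' then
    match desc_runs w' with
    | (b :: D) :: Ds =>
        if (b < a)%N then (a :: b :: D) :: Ds else [:: a] :: (b :: D) :: Ds
    | _ => [:: [:: a]]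
    end
  else [::].

Definition pop_stack (w : seq nat) : seq nat :=
  flatten [seq rev D | D <- desc_runs w].

Definition pop_stacked (n : nat) (s : 'S_n) : bool :=
  [exists t : 'S_n, one_line s == pop_stack (one_line t)].

Definition num_pop_stacked (n : nat) : nat := #|[set s : 'S_n | pop_stacked s]|.

(* A formal power series in Q[[x]] is its sequence of coefficients. *)
Definition fps : Type := nat -> rat.

Definition fps_of_poly (p : {poly rat}) : fps := fun k => p`_k.

Definition fps_one : fps := fun k => (k == 0%N)%:R.

Definition fps_mul (f g : fps) : fps :=
  fun k => \sum_(i < k.+1) f i * g (k - i)%N.

Definition fps_exp (f : fps) (j : nat) : fps := iter j (fps_mul f) fps_one.

Definition pop_stacked_gf : fps := fun n => (num_pop_stacked n)%:R.

(* The runs are nonempty and descending, they concatenate to w, and no two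
   consecutive runs can be merged; this determines them uniquely. *)
Lemma desc_runsP (w : seq nat) :
  [/\ flatten (desc_runs w) = w,
      all (fun D => (D != [::]) && sorted gtn D) (desc_runs w)
    & sorted (fun D E => (last 0%N D <= head 0%N E)%N) (desc_runs w)].
Proof.
elim: w => [|a w [IHw IHd IHm]] //=.
case: (desc_runs w) IHw IHd IHm => [|[|b D] Ds] //=.
  by move=> <-.
move=> <- /andP[bD dDs] m; case: ltnP => [ba|ab] /=.
  by rewrite ba bD dDs; split=> //; case: Ds m {dDs}.
by rewrite bD dDs ab.
Qed.

(* Main.v *)
(** The series F is in fact transcendental, because its coefficients grow
    superexponentially.  A permutation t is determined by P(t) together with
    the positions of its descents, so n! <= a_n 2^n.  On the other hand an
    algebraic power series has exponentially bounded coefficients: after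
    passing to derivatives, F is a simple root of some polynomial, and Newton's
    substitution F = T + x^k G, with T a long enough truncation of F, turns the
    equation into a fixpoint equation G = A + x Q(x, G).  For the norm
    sum_i |g_i| t^i and t small, its right-hand side maps a ball to itself, so
    all truncations of G have bounded norm.  Power series are represented
    throughout by their polynomial truncations. *)

Require Import Defs.
From Stdlib Require Import Classical.
From mathcomp Require Import all_boot all_order all_fingroup all_algebra.
From mathcomp Require Import ring zify.
Import Order.TTheory GRing.Theory Num.Theory.
Local Open Scope ring_scope.

(** * Pop-stack images, descents and the counting bound *)

Lemma perm_pop_stack (w : seq nat) : perm_eq (pop_stack w) w.
Proof.
have [e _ _] := desc_runsP w; rewrite -[X in perm_eq _ X]e /pop_stack.
by elim: (desc_runs w) => //= D Ds IH; apply: perm_cat; rewrite ?perm_rev.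
Qed.

Fixpoint desc_bits (w : seq nat) : bitseq :=
  if w is a :: w' then (if w' is b :: _ then (b < a)%N else false) :: desc_bits w'
  else [::].

(** Run lengths read off the descent bits: [true] joins a letter to the run that follows, [false]
    makes it the last letter of its run. *)
Fixpoint bits_shape (bs : bitseq) : seq nat :=
  if bs is b :: bs' then
    if b then incr_nth (bits_shape bs') 0 else 1%N :: bits_shape bs'
  else [::].

Lemma size_desc_bits (w : seq nat) : size (desc_bits w) = size w.
Proof. by elim: w => //= a w ->. Qed.

Lemma bits_shape_desc (w : seq nat) :
  bits_shape (desc_bits w) = shape (desc_runs w).
Proof.
elim: w => //= a w ->.
have [ew runs_ne _] := desc_runsP w.
case: (desc_runs w) ew runs_ne => [|[|b D] Ds] //= <- // _.
by case: ltnP.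
Qed.

(** The descent bits give the run lengths; cutting the image at these lengths recovers the reversed
    runs. *)
Lemma pop_stack_desc_bits_inj (v w : seq nat) :
  pop_stack v = pop_stack w -> desc_bits v = desc_bits w -> v = w.
Proof.
move=> ePop eBits.
have eSh : shape (desc_runs v) = shape (desc_runs w).
  by rewrite -!bits_shape_desc eBits.
have shE u : shape [seq rev D | D <- desc_runs u] = shape (desc_runs u).
  by rewrite /shape -map_comp; apply: eq_map => D /=; rewrite size_rev.
have runsE u : [seq rev D | D <- desc_runs u]
    = reshape (shape (desc_runs u)) (pop_stack u).
  by rewrite -shE flattenK.
have eRuns : desc_runs v = desc_runs w.
  by apply: (inj_map (can_inj (@revK nat))); rewrite !runsE eSh ePop.
by have [<- _ _] := desc_runsP v; have [<- _ _] := desc_runsP w; rewrite eRuns.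
Qed.

Lemma size_one_line {n : nat} (s : 'S_n) : size (one_line s) = n.
Proof. by rewrite size_map size_enum_ord. Qed.

Lemma one_line_inj {n : nat} : injective (@one_line n).
Proof.
move=> s t e; apply/permP => i; apply: val_inj; apply: succn_inj.
have /eq_in_map/(_ i) := e.
by apply; rewrite mem_enum.
Qed.

Lemma pop_stack_one_line {n : nat} (t : 'S_n) :
  exists s : 'S_n, one_line s == pop_stack (one_line t).
Proof.
have eT : one_line t = [tuple (t i).+1 | i < n] by [].
have /tuple_permP[q eq_q] : perm_eq (pop_stack (one_line t)) [tuple (t i).+1 | i < n].
  by rewrite -eT perm_pop_stack.
exists (q * t)%g; apply/eqP; rewrite eq_q /one_line.
by apply: eq_map => i; rewrite tnth_mktuple permM.
Qed.

Lemma fact_le_num_pop_stacked (n : nat) : (n`! <= num_pop_stacked n * 2 ^ n)%N.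
Proof.
pose pop (t : 'S_n) := xchoose (pop_stack_one_line t).
have popE t : one_line (pop t) = pop_stack (one_line t).
  exact/eqP/(xchooseP (pop_stack_one_line t)).
have szB (t : 'S_n) : size (desc_bits (one_line t)) == n.
  by rewrite size_desc_bits size_one_line.
pose f (t : 'S_n) := (pop t, Tuple (szB t)).
have f_inj : injective f.
  move=> s t [ePop eBits]; apply: one_line_inj.
  by apply: pop_stack_desc_bits_inj => //; rewrite -!popE ePop.
rewrite -card_Sn -(card_imset _ f_inj).
have -> : (num_pop_stacked n * 2 ^ n)%N =
    #|setX [set s : 'S_n | pop_stacked s] [set: n.-tuple bool]|.
  by rewrite cardsX cardsT card_tuple card_bool.
apply: subset_leq_card; apply/subsetP => _ /imsetP[t _ ->].
rewrite !inE andbT; apply/existsP; exists t; exact/eqP/popE.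
Qed.

(** * Factorials outgrow exponentials *)

Lemma expn_le_fact (m j : nat) : (m ^ j <= (m + j)`!)%N.
Proof.
elim: j => [|j IH]; first by rewrite expn0 fact_gt0.
rewrite addnS factS expnS leq_mul // ltnW // ltnS leq_addr //.
Qed.

(** The exponent [n.+1] leaves one factor [K] to absorb the constant in an exponential bound. *)
Lemma fact_superexponential (K : nat) : exists n : nat, (K ^ n.+1 < n`!)%N.
Proof.
(* With x = L^4 and n = 2x, n! >= x^x = L^(4x), and 4x > n + 1. *)
pose L := K.+2; exists (L ^ 4 + L ^ 4)%N.
apply: leq_trans (expn_le_fact _ _).
rewrite -expnM; apply: (@leq_ltn_trans (L ^ (L ^ 4 + L ^ 4).+1)).
  by rewrite leq_exp2r // leqW // leqnSn.
rewrite ltn_exp2l //.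
have : (1 < L ^ 4)%N by rewrite -(exp1n 4) ltn_exp2r.
by move: (L ^ 4)%N => x; lia.
Qed.

(** * Congruences modulo powers of x *)

Lemma dvdp_XnP {F : fieldType} (n : nat) (p : {poly F}) :
  reflect (forall i, (i < n)%N -> p`_i = 0) ('X^n %| p).
Proof.
apply: (iffP idP) => [/dvdpP[q ->] i lt_in|p0]; first by rewrite coefMXn lt_in.
rewrite -(poly_take_drop n p) (_ : take_poly n p = 0) ?add0r ?dvdp_mull //.
by apply/polyP => i; rewrite coef_take_poly coef0; case: ifP => // /p0.
Qed.

(** Used to see that arguments congruent modulo x^n have congruent values. *)
Lemma dvdp_hornerB {F : fieldType} (Q : {poly {poly F}}) (a b : {poly F}) :
  a - b %| Q.[a] - Q.[b].
Proof.
have /factor_theorem[q eq_q] : root (Q - Q.[b]%:P) b.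
  by rewrite rootE hornerD hornerN hornerC subrr.
have := congr1 (horner^~ a) eq_q.
by rewrite hornerD hornerN hornerC hornerM hornerXsubC => ->; rewrite dvdp_mull.
Qed.

(** * The weighted l^1 norm on polynomials *)

Definition wnorm {R : numFieldType} (t : R) (p : {poly R}) : R :=
  (map_poly Num.norm p).[t].

Section WeightedNorm.
Variables (R : numFieldType) (t : R).
Hypothesis t_ge0 : 0 <= t.

Lemma coef_norm_poly (p : {poly R}) (i : nat) :
  (map_poly Num.norm p)`_i = `|p`_i|.
Proof. by rewrite coef_map_id0 ?normr0. Qed.

Lemma wnormE (n : nat) (p : {poly R}) : (size p <= n)%N ->
  wnorm t p = \sum_(i < n) `|p`_i| * t ^+ i.
Proof.
move=> le_pn; rewrite /wnorm (@horner_coef_wide _ n).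
  by apply: eq_bigr => i _; rewrite coef_norm_poly.
by apply: leq_trans (size_poly _ _) le_pn.
Qed.

Lemma wnorm_ge0 (p : {poly R}) : 0 <= wnorm t p.
Proof.
by rewrite (wnormE _ _ (leqnn _)) sumr_ge0 // => i _; rewrite mulr_ge0 ?exprn_ge0.
Qed.

Lemma wnormC (c : R) : wnorm t c%:P = `|c|.
Proof.
by rewrite (wnormE _ _ (size_polyC_leq1 c)) big_ord1 coefC expr0 mulr1.
Qed.

Lemma wnormD (p q : {poly R}) : wnorm t (p + q) <= wnorm t p + wnorm t q.
Proof.
pose n := maxn (size p) (size q).
rewrite !(wnormE n) ?leq_maxl ?leq_maxr ?size_polyD // -big_split.
apply: ler_sum => i _ /=; rewrite -mulrDl coefD.
by rewrite ler_wpM2r ?exprn_ge0 // ler_normD.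
Qed.

Lemma wnormZ (c : R) (p : {poly R}) : wnorm t (c *: p) = `|c| * wnorm t p.
Proof.
rewrite !(wnormE (size p)) ?size_scale_leq // mulr_sumr.
by apply: eq_bigr => i _; rewrite coefZ normrM mulrA.
Qed.

Lemma wnormMX_addC (p : {poly R}) (c : R) :
  wnorm t (p * 'X + c%:P) = wnorm t p * t + `|c|.
Proof.
rewrite /wnorm -hornerMXaddC; congr _.[t]; apply/polyP => i.
rewrite coef_norm_poly !coefD !coefMX !coefC coef_norm_poly.
by case: i => [|i]; rewrite ?add0r ?addr0.
Qed.

Lemma wnormMX (p : {poly R}) : wnorm t (p * 'X) = wnorm t p * t.
Proof. by rewrite -[p * 'X]addr0 wnormMX_addC normr0 addr0. Qed.

Lemma wnormM (p q : {poly R}) : wnorm t (p * q) <= wnorm t p * wnorm t q.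
Proof.
elim/poly_ind: p => [|p c IH].
  by rewrite mul0r /wnorm map_poly0 horner0 mul0r.
have -> : (p * 'X + c%:P) * q = p * q * 'X + c *: q.
  by rewrite mulrDl mul_polyC mulrAC.
rewrite wnormMX_addC mulrDl (le_trans (wnormD _ _)) // wnormZ lerD2r wnormMX.
by rewrite [leRHS]mulrAC ler_wpM2r.
Qed.

Lemma wnorm_take (n : nat) (p : {poly R}) : wnorm t (take_poly n p) <= wnorm t p.
Proof.
rewrite -[in leRHS](poly_take_drop n p).
have := size_take_poly n p; set a := take_poly n p; set b := drop_poly n p => sza.
rewrite !(wnormE (maxn (size a) (size (a + b * 'X^n)))) ?leq_maxl ?leq_maxr //.
apply: ler_sum => i _; rewrite ler_wpM2r ?exprn_ge0 // coefD coefMXn.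
by case: ltnP => [_|le_ni]; rewrite ?addr0 // nth_default ?normr0 // (leq_trans sza).
Qed.

Lemma wnorm_coef_le (p : {poly R}) (i : nat) : `|p`_i| * t ^+ i <= wnorm t p.
Proof.
rewrite (wnormE (maxn (size p) i.+1)) ?leq_maxl //.
rewrite (bigD1 (Ordinal (leq_maxr (size p) i.+1))) //= lerDl.
by apply: sumr_ge0 => j _; rewrite mulr_ge0 ?exprn_ge0.
Qed.

(** The bound is uniform on the ball of radius [M], as a self-map argument requires. *)
Lemma wnorm_horner_le (Q : {poly {poly R}}) (g : {poly R}) (M : R) :
  wnorm t g <= M ->
  wnorm t Q.[g] <= \sum_(i < size Q) wnorm t Q`_i * M ^+ i.
Proof.
move=> leM; have M_ge0 := le_trans (wnorm_ge0 g) leM.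
have wX i : wnorm t (g ^+ i) <= M ^+ i.
  elim: i => [|i IH]; first by rewrite !expr0 wnormC normr1.
  by rewrite !exprS (le_trans (wnormM _ _)) // ler_pM ?wnorm_ge0.
rewrite horner_coef; elim/big_ind2: _ => [|x a y b xa yb|i _].
- by rewrite wnormC normr0.
- exact: le_trans (wnormD _ _) (lerD xa yb).
- by rewrite (le_trans (wnormM _ _)) // ler_wpM2l ?wnorm_ge0.
Qed.

End WeightedNorm.

Lemma wnorm_mono {R : numFieldType} (s t : R) (p : {poly R}) :
  0 <= s -> s <= t -> wnorm s p <= wnorm t p.
Proof.
move=> s_ge0 le_st; rewrite !(wnormE _ _ (size p)) //.
by apply: ler_sum => i _; rewrite ler_wpM2l // lerXn2r // nnegrE (le_trans s_ge0).
Qed.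

(** * Exponential bounds from fixpoint equations *)

Definition expo_bounded {R : numFieldType} (a : nat -> R) : Prop :=
  exists M C : R, [/\ 0 <= M, 0 <= C & forall n, `|a n| <= M * C ^+ n].

Lemma fixpoint_expo_bounded {R : numFieldType} (g : nat -> R)
    (A : {poly R}) (Q : {poly {poly R}}) :
  (forall n, 'X^n %| \poly_(i < n) g i - (A + 'X * Q.[\poly_(i < n) g i])) ->
  expo_bounded g.
Proof.
move=> eqG; pose G n := \poly_(i < n) g i.
pose M := wnorm 1 A + 1.
(* [B] bounds [Q] on the ball of radius [M] for every weight t <= 1. The choice t = 1/(B+1) gives B
   t <= 1, so the ball is mapped to itself. *)
pose B := \sum_(i < size Q) wnorm 1 Q`_i * M ^+ i.
have M_ge0 : 0 <= M by rewrite addr_ge0 ?wnorm_ge0.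
have B_ge0 : 0 <= B by rewrite sumr_ge0 // => i _; rewrite mulr_ge0 ?wnorm_ge0 ?exprn_ge0.
have B1_gt0 : 0 < B + 1 by rewrite ltr_wpDl.
pose t := (B + 1)^-1.
have t_gt0 : 0 < t by rewrite invr_gt0.
have t_ge0 := ltW t_gt0.
have t_le1 : t <= 1 by rewrite invf_le1 // lerDr.
(* The factor x gains one order, so each truncation is determined by the previous one. *)
have GS n : G n.+1 = take_poly n.+1 (A + 'X * Q.[G n]).
  have /dvdp_XnP eqn := eqG n.+1.
  have /dvdp_XnP eqG' : 'X^(n.+1) %| 'X * Q.[G n.+1] - 'X * Q.[G n].
    rewrite -mulrBr exprS dvdp_mul2l ?polyX_eq0 //.
    apply: dvdp_trans (dvdp_hornerB _ _ _); apply/dvdp_XnP => i lt_in.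
    by rewrite coefB !coef_poly lt_in ltnS ltnW ?subrr.
  apply/polyP => i; rewrite coef_take_poly; case: ltnP => [lt_in|le_ni].
    have := eqn i lt_in; have := eqG' i lt_in; rewrite !coefB !coefD -/(G n.+1).
    by move=> /subr0_eq <- /subr0_eq.
  by rewrite coef_poly ltnNge le_ni.
have GM n : wnorm t (G n) <= M.
  elim: n => [|n IH]; first by rewrite (wnormE _ _ 0) ?big_ord0 // size_poly.
  rewrite GS (le_trans (wnorm_take _ _ t_ge0 _ _)) //.
  rewrite (le_trans (wnormD _ _ t_ge0 _ _)) // lerD ?wnorm_mono // mulrC wnormMX //.
  apply: (@le_trans _ _ (B * t)).
    rewrite ler_wpM2r // (le_trans (wnorm_horner_le _ _ t_ge0 _ _ _ IH)) //.
    by apply: ler_sum => i _; rewrite ler_wpM2r ?exprn_ge0 ?wnorm_mono.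
  by rewrite ler_pdivrMr // mul1r lerDl.
exists M, (B + 1); split=> // [|n]; first exact: ltW.
have := le_trans (wnorm_coef_le _ _ t_ge0 _ n) (GM n.+1).
by rewrite coef_poly ltnSn exprVn ler_pdivrMr ?exprn_gt0.
Qed.

Lemma expo_bounded_shift {R : numFieldType} (a : nat -> R) (k : nat) :
  expo_bounded (fun i => a (i + k)%N) -> expo_bounded a.
Proof.
move=> [M [C [M_ge0 C_ge0 leM]]].
(* [S] covers the first [k] terms; [C + 1] is at least 1, so its powers increase and the shift of
   the exponent is harmless. *)
pose S := \sum_(i < k) `|a i|.
have S_ge0 : 0 <= S by rewrite sumr_ge0.
have C1_ge1 : 1 <= C + 1 by rewrite lerDr.
exists (M + S), (C + 1); split; rewrite ?addr_ge0 // => n.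
have [lt_nk|le_kn] := ltnP n k.
  have le_aS : `|a n| <= S.
    by rewrite /S (bigD1 (Ordinal lt_nk)) //= lerDl sumr_ge0.
  rewrite (le_trans le_aS) // (@le_trans _ _ (M + S)) ?lerDr //.
  by rewrite ler_peMr ?addr_ge0 // exprn_ege1.
have := leM (n - k)%N; rewrite subnK // => /le_trans; apply.
rewrite ler_pM ?exprn_ge0 ?lerDl // (@le_trans _ _ ((C + 1) ^+ (n - k))) //.
  by rewrite lerXn2r ?nnegrE ?addr_ge0 // lerDl.
by rewrite ler_weXn2l // leq_subr.
Qed.

(** * Newton's substitution and algebraic series *)

Lemma horner_taylor2 {A : comNzRingType} (P : {poly A}) (x : A) :
  exists Q : {poly A},
    forall h, P.[x + h] = P.[x] + P^`().[x] * h + h ^+ 2 * Q.[h].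
Proof.
elim/poly_ind: P => [|p c [Q PQ]].
  by exists 0 => h; rewrite deriv0 !horner0 mul0r mulr0 !addr0.
exists (Q * ('X + x%:P) + (p^`().[x])%:P) => h.
rewrite derivD derivC derivM derivX mulr1 addr0 !hornerE PQ; ring.
Qed.

(** This says P(F) = 0 for the series F with coefficients [a], since P(F) and the value at the n-th
    truncation agree modulo x^n. *)
Definition fps_root {R : fieldType} (a : nat -> R) (P : {poly {poly R}}) : Prop :=
  forall n, 'X^n %| P.[\poly_(i < n) a i].

Lemma dvdp_poly_trunc {F : fieldType} (a : nat -> F) (n m1 m2 : nat) :
  (n <= m1)%N -> (n <= m2)%N ->
  'X^n %| \poly_(i < m1) a i - \poly_(i < m2) a i.
Proof.
move=> le1 le2; apply/dvdp_XnP => i lt_in.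
by rewrite coefB !coef_poly !(leq_trans lt_in) ?subrr.
Qed.

Lemma simple_root_expo_bounded {R : numFieldType} (a : nat -> R)
    (P : {poly {poly R}}) :
  fps_root a P -> ~ fps_root a P^`() -> expo_bounded a.
Proof.
move=> rootP /not_all_ex_not[N /negP ndvd].
pose F n := \poly_(i < n) a i.
have exs : exists i, (i < N)%N && ((P^`().[F N])`_i != 0).
  have : ~~ [forall i : 'I_N, (P^`().[F N])`_i == 0].
    apply: contra ndvd => /forallP all0; apply/dvdp_XnP => i lt_iN.
    exact/eqP/(all0 (Ordinal lt_iN)).
  by rewrite negb_forall => /existsP[i Di]; exists i; rewrite ltn_ord.
(* [s] is the x-adic order of P'(F). A truncation [T] with s + 1 terms suffices for P'(T) to have
   the same order, so P'(T) = x^s u with u(0) nonzero. *)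
case: (ex_minnP exs) => s /andP[lt_sN Ds_neq0] min_s.
pose k := s.+1; pose T := F k.
have coefDT i : (i < k)%N -> (P^`().[T])`_i = (P^`().[F N])`_i.
  move=> lt_ik; apply/eqP; rewrite -subr_eq0 -coefB.
  have /dvdp_XnP-> // : 'X^k %| P^`().[T] - P^`().[F N].
  by apply: dvdp_trans (dvdp_hornerB _ _ _); apply: dvdp_poly_trunc.
have /dvdpP[u Du] : 'X^s %| P^`().[T].
  apply/dvdp_XnP => i lt_is; rewrite coefDT 1?ltnW //.
  apply: contraTeq (lt_is) => Di; rewrite -leqNgt min_s // Di andbT.
  exact: ltn_trans lt_is lt_sN.
have u0_neq0 : u`_0 != 0.
  by move: Ds_neq0; rewrite -coefDT // Du coefMXn ltnn subnn.
(* All terms but P(T) are divisible by x^(s+k), hence so is P(T); dividing by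
   x^(s+k) leaves A0 + u G + x G^2 Q(x^k G), with u(0) <> 0. *)
have [Q taylorP] := horner_taylor2 P T.
pose g i := a (i + k)%N; pose G n := \poly_(i < n) g i.
have FE n : F (k + n)%N = T + 'X^k * G n.
  apply/polyP => i; rewrite coefD coefXnM /T /F /G !coef_poly.
  case: (ltnP i k) => lt_ik; first by rewrite ltn_addr // addr0.

  by rewrite add0r ltn_subLR // /g subnK // addnC.
(* The quadratic term carries x^(2k) = x^(s+k) x because k = s + 1; this is the spare factor x. *)
have PF n : P.[F (k + n)%N] = P.[T] +
    'X^(s + k) * (u * G n + 'X * (G n ^+ 2 * Q.['X^k * G n])).
  rewrite FE taylorP Du {1 2 3}/k !exprD !exprS; ring.
have /dvdpP[A0 PT] : 'X^(s + k) %| P.[T].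
  have dvd : 'X^(s + k) %| P.[F (k + k)%N].
    by apply: dvdp_trans (rootP _); rewrite dvdp_exp2l // leq_add2r ltnW.
  by move: dvd; rewrite PF dvdp_addl // dvdp_mulr.
have /dvdpP[u1 Du1] : 'X %| u - (u`_0)%:P.
  rewrite -['X]expr1; apply/dvdp_XnP => -[] // _.
  by rewrite coefB coefC subrr.
(* Here the outer ['X] is the unknown G and ['X%:P] is x. Splitting u = u(0) + x u1 gives E(G) = A0
   + u(0) G + x S(G). *)
pose S := u1%:P * 'X + 'X^2 * (Q \Po ('X^k%:P * 'X)).
pose E := A0%:P + u%:P * 'X + 'X%:P * ('X^2 * (Q \Po ('X^k%:P * 'X))).
have EE n : E.[G n] = A0 + u * G n + 'X * (G n ^+ 2 * Q.['X^k * G n]).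
  by rewrite !(hornerE, horner_comp).
have dvdE n : 'X^n %| E.[G n].
  (* Division by x^(s+k) costs precision, so a truncation longer by [s] terms is used first. *)
  have dvd1 : 'X^n %| E.[G (n + s)%N].
    have := rootP (k + (n + s))%N; rewrite PF PT mulrC -mulrDr addrA -EE.
    have -> : (k + (n + s) = s + k + n)%N by rewrite addnCA addnC (addnC k).
    by rewrite exprD dvdp_mul2l // expf_neq0 // polyX_eq0.
  rewrite -(subrK E.[G (n + s)%N] E.[G n]) dvdp_addl //.
  by apply: dvdp_trans (dvdp_hornerB _ _ _); apply: dvdp_poly_trunc; rewrite ?leq_addr.
apply: (expo_bounded_shift _ k).
(* Dividing by u(0) turns E(G) = 0 into G = - v A0 + x (- v S(G)). *)
pose v := (u`_0)^-1%:P : {poly R}.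
apply: (fixpoint_expo_bounded _ (- v * A0) ((- v)%:P * S)) => n.
have -> : \poly_(i < n) g i - (- v * A0 + 'X * ((- v)%:P * S).[\poly_(i < n) g i])
    = v * E.[G n].
  have uE : u = u1 * 'X + (u`_0)%:P by rewrite -Du1 subrK.
  have vu : v * (u`_0)%:P = 1 by rewrite -polyCM mulVf.
  have SE : S.[G n] = u1 * G n + G n ^+ 2 * Q.['X^k * G n].
    by rewrite !(hornerE, horner_comp).
  rewrite EE [in RHS]uE -/(G n) hornerM hornerC SE.
  by rewrite -[X in X - _]mul1r -vu; ring.
by rewrite dvdp_mull.
Qed.

(** Induction on the size of [P]: either the root is simple, or P' is a smaller equation for the
    same series. *)
Lemma algebraic_expo_bounded {R : numFieldType} (a : nat -> R)
    (P : {poly {poly R}}) :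
  P != 0 -> fps_root a P -> expo_bounded a.
Proof.
have [n] := ubnP (size P); elim: n P => // n IH P le_Pn P_neq0 rootP.
have [rootP'|] := classic (fps_root a P^`()); last exact: simple_root_expo_bounded.
have [P'0|P'_neq0] := eqVneq P^`() 0; last first.
  by apply: IH rootP' => //; apply: leq_trans (lt_size_deriv P_neq0) _.
(* In characteristic 0 a zero derivative forces [P] to be a constant c(x); a nonzero c is not
   divisible by x^n for n = [size c]. *)
have szP : (size P <= 1)%N.
  apply/leq_sizeP => -[//|i] _; have := congr1 (fun q : {poly {poly R}} => q`_i) P'0.
  rewrite coef_deriv coef0 => /polyP coefs0; apply/polyP => l.
  by have /eqP := coefs0 l; rewrite coefMn coef0 mulrn_eq0 => /eqP.
move: P_neq0 rootP; rewrite (size1_polyC szP) polyC_eq0; set c := P`_0 => c_neq0.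
move=> /(_ (size c)); rewrite hornerC => /(dvdp_leq c_neq0).
by rewrite size_polyXn ltnn.
Qed.

(** * Transcendence of the pop-stacked series *)

Lemma fps_exp_trunc (f : fps) (n j k : nat) : (k < n)%N ->
  fps_exp f j k = ((\poly_(i < n) f i) ^+ j)`_k.
Proof.
elim: j k => [|j IH] k lt_kn; first by rewrite expr0 coef1.
rewrite exprS coefM [LHS]/(fps_mul f (fps_exp f j) k).
apply: eq_bigr => i _; rewrite IH ?(leq_ltn_trans (leq_subr _ _)) //.
by rewrite coef_poly (leq_ltn_trans _ lt_kn) // -ltnS.
Qed.

Lemma pop_stacked_gf_not_expo_bounded : ~ expo_bounded pop_stacked_gf.
Proof.
move=> [M [C [M_ge0 C_ge0 le_a]]].
(* [K] dominates both M and 2C, whence n! <= a_n 2^n <= M (2C)^n <= K^(n+1) for all n. *)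
pose K := maxn (Num.bound M) (Num.bound (C * 2)).
have leK x : 0 <= x -> (Num.bound x <= K)%N -> x <= K%:R :> rat.
  by move=> x0 le_xK; rewrite (le_trans (ltW (archi_boundP x0))) ?ler_nat.
have [n] := fact_superexponential K; apply/negP; rewrite -leqNgt.
rewrite -(ler_nat rat) (@le_trans _ _ ((num_pop_stacked n * 2 ^ n)%:R)) //.
  by rewrite ler_nat fact_le_num_pop_stacked.
have := le_a n; rewrite normr_nat natrM natrX => le_an.
rewrite (le_trans (ler_wpM2r _ le_an)) ?exprn_ge0 // -mulrA -exprMn natrX exprS.
have C2_ge0 : 0 <= C * 2 by rewrite mulr_ge0.
rewrite ler_pM ?exprn_ge0 ?leK ?leq_maxl // lerXn2r ?nnegrE //.
by rewrite leK ?leq_maxr.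
Qed.

Theorem mainTheorem6 (m : nat) (hm : (1 <= m)%N) (p : 'I_m.+1 -> {poly rat})
    (hpm : p ord_max != 0)
    (hF : forall k : nat,
       \sum_(j < m.+1)
          fps_mul (fps_of_poly (p j)) (fps_exp pop_stacked_gf j) k = 0)
    (d : nat) (hd : d = (\max_(j < m.+1) (size (p j)).-1)%N) :
  (1000 < (m + 1) * (d + 1))%N.
Proof.
(* The hypotheses are contradictory: the equation would make the coefficients exponentially
   bounded. *)
case: pop_stacked_gf_not_expo_bounded.
apply: (algebraic_expo_bounded _ (\poly_(j < m.+1) p (inord j))).
  apply: contra hpm => /eqP/(congr1 (fun q : {poly {poly rat}} => q`_m)).
  by rewrite coef_poly ltnSn coef0 -[ord_max]inord_val => ->.
move=> n; apply/dvdp_XnP => k lt_kn.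
(* Below order n, truncating F does not change the coefficients of the equation. *)
rewrite (horner_coef_wide _ (size_poly _ _)) coef_sum -[RHS](hF k).
apply: eq_bigr => j _; rewrite coef_poly ltn_ord inord_val coefM.
apply: eq_bigr => i _; rewrite (fps_exp_trunc _ n) //.
by rewrite (leq_ltn_trans (leq_subr _ _)).
Qed.
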